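(* Let $t(n)$ be a sequence of natural numbers, let $\mathrm{GF}_t(z)=\sum_{i=0}^\infty t(i)z^i$ and let $R$ be the radius of convergence of $\mathrm{GF}_t(z)$ at zero. Let $b$ and $n$ be positive integers such that $b\ge 8$, $b^{-1}<R$, and $t(r)<b^{r/3}$ for every integer $r\ge 1$. Then $$t(n)=\left\lfloor b^{n^2}\,\mathrm{GF}_t(b^{-n})\right\rfloor \bmod b^n .$$
   Context: Natural numbers are the non-negative integers. $\mathrm{GF}_t(b^{-n})$ denotes the (real) sum of the power series $\sum_{i\ge 0} t(i) b^{-ni}$. For an integer $y\ge 1$, $x \bmod y$ denotes the least non-negative residue of $x$ modulo $y$. *)

(* Defs.v *)
From Stdlib Require Import Reals ZArith.
From Coquelicot Require Import Coquelicot.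

Open Scope R_scope.

Definition GF_coef (t : nat -> nat) : nat -> R := fun i => INR (t i).

Definition GF (t : nat -> nat) (z : R) : R := PSeries (GF_coef t) z.

(* Possibly [p_infty], e.g. when [t] is eventually zero. *)
Definition GF_radius (t : nat -> nat) : Rbar := CV_radius (GF_coef t).

(* Main.v *)
Require Import Defs.
From Stdlib Require Import Reals ZArith Lra Lia.
From Coquelicot Require Import Coquelicot.

Open Scope R_scope.

(** Multiplying the series by [b ^ (n ^ 2)] turns the terms of index [i < n] into
    integers divisible by [b ^ n] and the term of index [n] into [t n]. With
    [c = b ^ (1/3) >= 2] the term of index [n + k], [k >= 1], is at most
    [c ^ (n + k - 3 n k) <= c ^ (1 - 2 k) <= 2 / 4 ^ k], so the terms beyond [n]
    add up to at most [2/3 < 1] and disappear under the floor; moreover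
    [t n < c ^ n <= b ^ n]. *)

Lemma Rpower_third_cube (x : R) : 0 < x -> Rpower x (1 / 3) ^ 3 = x.
Proof.
intros Hx.
rewrite <- Rpower_pow by (unfold Rpower; apply exp_pos).
rewrite Rpower_mult.
replace (1 / 3 * INR 3) with 1 by (simpl; field).
now apply Rpower_1.
Qed.

(** This trades the real exponent in the growth bound on [t] for a natural power of the cube root,
    so all later estimates are about [pow]. *)
Lemma Rpower_third_pow (x : R) (r : nat) : Rpower x (INR r / 3) = Rpower x (1 / 3) ^ r.
Proof.
rewrite <- Rpower_pow by (unfold Rpower; apply exp_pos).
rewrite Rpower_mult; f_equal; field.
Qed.

Lemma Rpower_third_ge_2 (x : R) : 8 <= x -> 2 <= Rpower x (1 / 3).
Proof.
intros Hx.
destruct (Rle_lt_dec 2 (Rpower x (1 / 3))) as [H | H]; [exact H | exfalso].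
assert (H0 : 0 < Rpower x (1 / 3)) by (unfold Rpower; apply exp_pos).
pose proof (Rpower_third_cube x ltac:(lra)) as H3.
assert (H2 : Rpower x (1 / 3) ^ 2 < 4) by nra.
simpl in *; nra.
Qed.

(** The exponent left after cancellation is [n ^ 2 - n * i]; describing it additively through [m]
    avoids truncated subtraction and forces [i <= n] when [n > 0]. *)
Lemma scaled_term (B v : R) (n m i : nat) :
  0 < B -> (n * i + m = n ^ 2)%nat -> B ^ (n ^ 2) * (v * (/ B ^ n) ^ i) = v * B ^ m.
Proof.
intros HB E.
rewrite <- E, pow_add, pow_mult, pow_inv.
field; apply pow_nonzero, pow_nonzero; lra.
Qed.

(** For [i < n] the surviving exponent is [n * (n - i - 1) + n], so a factor [b ^ n] splits off each
    term. The upper index [m] is kept free for the induction. *)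
Lemma scaled_head_multiple (t : nat -> nat) (b n m : nat) :
  (0 < b)%nat -> (m < n)%nat ->
  exists q : nat,
    INR b ^ (n ^ 2) * sum_f_R0 (fun i => INR (t i) * (/ INR b ^ n) ^ i) m
    = INR (q * b ^ n).
Proof.
intros Hb.
assert (HB : 0 < INR b) by (apply lt_0_INR; lia).
assert (Hterm : forall i, (i < n)%nat ->
  INR b ^ (n ^ 2) * (INR (t i) * (/ INR b ^ n) ^ i)
  = INR (t i * b ^ (n * (n - i - 1)) * b ^ n)).
{ intros i Hi.
  rewrite (scaled_term _ _ n (n * (n - i - 1) + n) i HB).
  - rewrite !mult_INR, !pow_INR, pow_add; ring.
  - replace (n ^ 2)%nat with (n * n)%nat by (simpl; lia).
    (* Substituting [n = i + 1 + d] removes the truncated subtraction and leaves a polynomial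
       identity. *)
    set (d := (n - i - 1)%nat).
    replace n with (i + 1 + d)%nat by (unfold d; lia).
    ring. }
induction m as [| m IH]; intros Hm.
- eexists; simpl sum_f_R0; apply (Hterm 0%nat Hm).
- destruct IH as [q Hq]; [lia |].
  exists (q + t (S m) * b ^ (n * (n - S m - 1)))%nat.
  rewrite tech5, Rmult_plus_distr_l, Hq, (Hterm _ Hm), <- plus_INR.
  f_equal; ring.
Qed.

(** Scaling leaves [v / c ^ (3 * n * (k + 1))]. Since [n >= 1], we have [(2 * k + 1) + (n + 1 + k)
    <= 3 * n * (k + 1)], which leaves at least [2 * k + 1] spare factors [c >= 2] in the
    denominator. *)
Lemma scaled_tail_term (c v : R) (n k : nat) :
  2 <= c -> (0 < n)%nat -> v <= c ^ (S n + k) ->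
  (c ^ 3) ^ (n ^ 2) * (v * (/ (c ^ 3) ^ n) ^ (S n + k)) <= / 2 * (/ 4) ^ k.
Proof.
intros Hc Hn Hv.
assert (HB : 0 < c ^ 3) by (apply pow_lt; lra).
assert (HBk : 0 < (c ^ 3) ^ (n * S k)) by (apply pow_lt, HB).
assert (E : (c ^ 3) ^ (n ^ 2) * (v * (/ (c ^ 3) ^ n) ^ (S n + k))
            = v / (c ^ 3) ^ (n * S k)).
{ replace (S n + k)%nat with (n + S k)%nat by lia.
  replace (n ^ 2)%nat with (n * n)%nat by (simpl; lia).
  rewrite pow_inv, <- (pow_mult (c ^ 3)), Nat.mul_add_distr_l, pow_add.
  field; split; apply pow_nonzero; lra. }
rewrite E.
apply Rle_div_l; [exact HBk |].
(* The multiplier is the reciprocal of the target bound [/ 2 * (/ 4) ^ k]. *)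
apply (Rmult_le_reg_l (2 ^ (2 * k + 1))); [apply pow_lt; lra |].
replace (2 ^ (2 * k + 1) * (/ 2 * (/ 4) ^ k * (c ^ 3) ^ (n * S k)))
  with ((c ^ 3) ^ (n * S k)).
2:{ rewrite pow_add, (pow_mult 2), (pow_inv 4); replace (2 ^ 2) with 4 by ring.
    field; apply pow_nonzero; lra. }
rewrite <- pow_mult.
apply Rle_trans with (c ^ (2 * k + 1) * c ^ (S n + k)).
- apply Rle_trans with (2 ^ (2 * k + 1) * c ^ (S n + k)).
  + apply Rmult_le_compat_l; [apply pow_le; lra | exact Hv].
  + apply Rmult_le_compat_r; [apply pow_le; lra | apply pow_incr; lra].
- rewrite <- pow_add; apply Rle_pow; [lra | nia].
Qed.

Lemma series_geometric_half_quarter : is_series (fun k => / 2 * (/ 4) ^ k) (2 / 3).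
Proof.
replace (2 / 3) with (/ 2 * / (1 - / 4)) by field.
apply (is_series_scal_l (/ 2) (fun k => (/ 4) ^ k)).
apply is_series_geom; rewrite Rabs_pos_eq; lra.
Qed.

Lemma series_between_zero_and (u v : nat -> R) (l : R) :
  (forall k, 0 <= u k <= v k) -> is_series v l -> ex_series u /\ 0 <= Series u <= l.
Proof.
intros Huv Hv.
assert (Hex : ex_series u).
{ apply (ex_series_le u v); [| now exists l].
  intros k; change (Rabs (u k) <= v k); rewrite Rabs_pos_eq; apply Huv. }
split; [exact Hex | split].
(* The zero series is written as a multiple of [u] so that [Series_scal_l] evaluates it. *)
- replace 0 with (Series (fun k : nat => 0 * u k)).
  + apply Series_le; [| exact Hex].
    intros k; specialize (Huv k); lra.
  + rewrite Series_scal_l; ring.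
- rewrite <- (is_series_unique _ _ Hv).
  apply Series_le; [exact Huv | now exists l].
Qed.

Theorem theorem4p2 (t : nat -> nat) (b n : nat)
  (hb0 : (0 < b)%nat) (hn0 : (0 < n)%nat)
  (hb : (8 <= b)%nat)
  (hR : Rbar_lt (Finite (/ INR b)) (GF_radius t))
  (ht : forall r : nat, (1 <= r)%nat -> INR (t r) < Rpower (INR b) (INR r / 3)) :
  Z.of_nat (t n) =
    (Zfloor (INR b ^ (n ^ 2) * GF t (/ (INR b ^ n))) mod Z.of_nat (b ^ n))%Z.
Proof.
assert (HB8 : 8 <= INR b) by (apply le_INR in hb; simpl in hb; lra).
set (a := fun i => INR (t i) * (/ INR b ^ n) ^ i).
set (K := INR b ^ (n ^ 2)).
assert (HK : 0 < K) by (apply pow_lt; lra).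
set (c := Rpower (INR b) (1 / 3)).
assert (Hc : 2 <= c) by (apply Rpower_third_ge_2, HB8).
assert (Hc3 : c ^ 3 = INR b) by (apply Rpower_third_cube; lra).
assert (Htc : forall r, (1 <= r)%nat -> INR (t r) < c ^ r).
{ intros r Hr; unfold c; rewrite <- Rpower_third_pow; apply ht, Hr. }
assert (Htail : forall k, 0 <= K * a (S n + k)%nat <= / 2 * (/ 4) ^ k).
{ intros k; split.
  - apply Rmult_le_pos; [lra |].
    apply Rmult_le_pos; [apply pos_INR |].
    apply pow_le, Rlt_le, Rinv_0_lt_compat, pow_lt; lra.
  - unfold K, a; rewrite <- Hc3; apply scaled_tail_term; [exact Hc | exact hn0 |].
    apply Rlt_le, Htc; lia. }
destruct (series_between_zero_and _ _ _ Htail series_geometric_half_quarter)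
  as [Hex [Htail0 Htail1]].
(* Convergence comes from the dominated tail: undo the scaling by [K], then restore the finitely
   many initial terms. *)
assert (Ha : ex_series a).
{ apply (ex_series_incr_n a (S n)).
  apply ex_series_ext with (fun k => / K * (K * a (S n + k)%nat)).
  - intros k; rewrite <- Rmult_assoc, Rinv_l by lra; apply Rmult_1_l.
  - apply (ex_series_scal_l (/ K) _ Hex). }
destruct (scaled_head_multiple t b n (pred n) hb0 ltac:(lia)) as [q Hq].
assert (Hn : K * a n = INR (t n)).
{ unfold K, a; rewrite (scaled_term _ _ n 0 n); [ring | lra | simpl; lia]. }
assert (HS : K * GF t (/ INR b ^ n)
  = INR (q * b ^ n + t n) + Series (fun k => K * a (S n + k)%nat)).
{ unfold GF, PSeries; change (K * Series a
    = INR (q * b ^ n + t n) + Series (fun k => K * a (S n + k)%nat)).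
  rewrite (Series_incr_n a (S n)) by (lia || exact Ha).
  rewrite Series_scal_l, plus_INR, <- Hq, <- Hn; simpl pred.
  fold K; fold a.
  (* [sum_f_R0] includes its upper index, so the terms with [i < n] end at [pred n]; at [n = 0] this
     splitting would count [a 0] twice. *)
  replace (sum_f_R0 a n) with (sum_f_R0 a (pred n) + a n).
  - ring.
  - destruct n; [lia | reflexivity]. }
assert (Hlt : (t n < b ^ n)%nat).
{ apply INR_lt; rewrite pow_INR, <- Hc3, <- pow_mult.
  apply Rlt_le_trans with (c ^ n); [apply Htc, hn0 |].
  apply Rle_pow; [lra | lia]. }
rewrite HS, (Zfloor_eq (Z.of_nat (q * b ^ n + t n))).
2:{ rewrite <- INR_IZR_INZ; lra. }
rewrite Nat2Z.inj_add, Nat2Z.inj_mul, Z.add_comm, Z.mod_add by lia.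
symmetry; apply Z.mod_small; lia.
Qed.
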